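(* For every $\delta\in\left(0,\frac{1}{16}\right)$ there exists a constant $c_1(\delta)>0$, depending only on $\delta$, such that the following holds. Let $m\ge 3$ be an integer or $m=\infty$, and let $\boldsymbol{\xi}=(\xi_1,\dots,\xi_n)^{\mathrm T}\in\mathbb{C}^n$ be a random vector whose entries are i.i.d. uniformly distributed on $\mathbf{\Omega}_m$. Then for any $\boldsymbol{a}\in\mathbb{C}^n$, $$\mathrm{Prob}\left\{\mathrm{Re}\,(\boldsymbol{a}^{\mathrm T}\boldsymbol{\xi})\ge\sqrt{\frac{\delta\ln n}{n}}\,\|\boldsymbol{a}\|_1\right\}\ge\frac{c_1(\delta)}{c_2(m)\,n^{5\delta}},$$ where $c_2(m):=\min\{k\ge 2: k\text{ is a divisor of }m\}\le m$ for integer $m$ and, in particular, $c_2(\infty)=2$.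
   Context: For an integer $m$, $\mathbf{\Omega}_m=\{1,\omega_m,\dots,\omega_m^{m-1}\}$ with $\omega_m=e^{\mathbf{i}2\pi/m}$; $\mathbf{\Omega}_\infty=\{z\in\mathbb{C}:|z|=1\}$. For $\boldsymbol{a}\in\mathbb{C}^n$, $\|\boldsymbol{a}\|_1=\sum_{i=1}^n|a_i|$, and $\boldsymbol{a}^{\mathrm T}\boldsymbol{\xi}=\sum_{i=1}^n a_i\xi_i$ (no conjugation). *)

(* Defs.v *)
From HB Require Import structures.
From mathcomp Require Export all_boot all_order all_algebra.
From mathcomp Require Export all_classical all_reals all_analysis.
From mathcomp Require Export complex.

Set Implicit Arguments.
Unset Strict Implicit.
Unset Printing Implicit Defensive.

Import Order.TTheory GRing.Theory Num.Theory.
Import numFieldNormedType.Exports.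

Local Open Scope classical_set_scope.
Local Open Scope ring_scope.
Local Open Scope complex_scope.

(* Throughout, the parameter m ranges over [option nat]: [Some k] is the
   integer k and [None] is m = oo. *)
Definition admissible (m : option nat) : bool :=
  if m is Some k then (3 <= k)%N else true.

(* The default value k of the iterated minimum is itself a divisor of k, so for
   k >= 2 this is the least divisor >= 2 (see c2_min). *)
Definition c2 (m : option nat) : nat :=
  if m is Some k then \big[minn/k]_(2 <= d < k.+1 | (d %| k)%N) d else 2%N.

Lemma c2_min (k : nat) : (2 <= k)%N ->
  [/\ (2 <= c2 (Some k))%N, (c2 (Some k) %| k)%N, (c2 (Some k) <= k)%N
    & forall d, (2 <= d)%N -> (d %| k)%N -> (c2 (Some k) <= d)%N].
Proof.
move=> k2; rewrite /c2.
have P : (2 <= \big[minn/k]_(2 <= d < k.+1 | (d %| k)%N) d)%N /\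
         (\big[minn/k]_(2 <= d < k.+1 | (d %| k)%N) d %| k)%N.
  rewrite big_nat_cond.
  elim/big_ind: _ => [//|x y [x2 xk] [y2 yk]|d /andP[/andP[]]//].
  by rewrite /minn; case: ifP.
have M d : (2 <= d)%N -> (d %| k)%N ->
    (\big[minn/k]_(2 <= d < k.+1 | (d %| k)%N) d <= d)%N.
  move=> d2 dk; have dk' : (d <= k)%N by rewrite dvdn_leq// (ltn_trans _ k2).
  have: d \in index_iota 2 k.+1 by rewrite mem_index_iota d2 ltnS.
  elim: (index_iota 2 k.+1) => // x s IHs; rewrite inE big_cons.
  case/predU1P => [<-|/IHs ds]; first by rewrite dk geq_minl.
  by case: ifP => // _; rewrite geq_min ds orbT.
by case: P => P2 Pk; split=> //; exact: M.
Qed.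

Section defs.
Variable R : realType.

Definition expi (theta : R) : R[i] := cos theta +i* sin theta.

Definition omega (k : nat) : R[i] := expi (2 * pi / k%:R).

Definition Omega (m : option nat) : set R[i] :=
  if m is Some k then [set omega k ^+ j | j in `I_k]
  else [set z | `|z| = 1].

Lemma Omega_expi (theta : R) : Omega None (expi theta).
Proof. by rewrite /Omega /= normc_def /= cos2Dsin2 sqrtr1. Qed.

(* normc is the R-valued modulus; `|z| lives in R[i]. *)
Definition norm1 (n : nat) (a : 'cV[R[i]]_n) : R := \sum_i ComplexField.Normc.normc (a i 0).

(* Borel subsets of the complex plane, identified with R * R. *)
Definition borelC (B : set R[i]) : Prop :=
  measurable [set p : R * R | B (p.1 +i* p.2)].

Section random.
Context (d : measure_display) (T : measurableType d) (P : probability T R).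

Definition complex_rv (X : T -> R[i]) : Prop :=
  forall B, borelC B -> measurable (X @^-1` B).

(* On the circle, the uniform law is normalized arc length, i.e. the law of
   expi theta for theta Lebesgue-uniform on [0, 2 pi]. *)
Definition uniform_on_Omega (m : option nat) (X : T -> R[i]) : Prop :=
  match m with
  | Some k => forall z, Omega (Some k) z -> P (X @^-1` [set z]) = (k%:R^-1)%:E
  | None => forall B, borelC B -> P (X @^-1` B) =
      ((2 * pi)^-1%:E *
       lebesgue_measure (`[0%R, (2 * pi)%R] `&` expi @^-1` B))%E
  end.

Definition mutually_independent (n : nat) (X : 'I_n -> T -> R[i]) : Prop :=
  forall (J : {set 'I_n}) (B : 'I_n -> set R[i]), (forall i, borelC (B i)) ->
    P (\bigcap_(i in [set` J]) (X i @^-1` B i)) =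
    (\prod_(i in J) P (X i @^-1` B i))%E.

Definition iid_uniform (m : option nat) (n : nat) (xi : T -> 'cV[R[i]]_n) :
    Prop :=
  [/\ forall i, complex_rv (fun t => xi t i 0),
      forall i, uniform_on_Omega m (fun t => xi t i 0)
    & mutually_independent (fun i t => xi t i 0)].

End random.
End defs.

(* Main.v *)
Require Import Defs.
From mathcomp Require Import measurable_realfun.
From mathcomp Require Import ring lra.

Set Implicit Arguments.
Unset Strict Implicit.
Unset Printing Implicit Defensive.

Import Order.TTheory GRing.Theory Num.Theory.
Import numFieldNormedType.Exports.

Local Open Scope classical_set_scope.
Local Open Scope ring_scope.

(** The summands X_i = Re (a_i xi_i) enter the proof only through three facts:
with b_i = |a_i|, they have mean 0, second moment b_i^2/2, and |X_i| <= b_i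
(the predicate [spread]).  For m >= 3 these facts hold because the m-th roots
of unity and their squares both sum to 0.

The circle is reduced to the finite case.  Cut it into M equal arcs; on an arc
the variable stays close to the centre of the arc, and the M centres form a
rotated copy of the M-th roots of unity.  Hence it suffices to treat finite m,
that is, to count functions f : 'I_n -> 'I_m, provided the counting theorem
[freq_sum_ge_pow_card] holds uniformly in m and with a threshold tau strictly
above sqrt (delta ln n / n); this excess absorbs the width of the arcs.

Let A be the sum of the b_i^2 over a set of coordinates and Y the sum of the
corresponding X_i.  As long as s b_i is small, E e^(sY) is e^(s^2 A/4) up to a
small relative error in the exponent ([mean_expR_psum]), as for a Gaussian of
variance A/2.  Exponential tilting ([mean_expR_le_freq]) turns this into lower
tail bounds: Y >= sqrt (D A) with probability at least e^(-3.795 D)/2 if D >= 20 and the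
coordinates are spread out enough ([freq_psum_gaussian]), and Y >= c sqrt A
with a universal probability p > 0 in all cases ([freq_psum_std]).

For large n, the coordinates are split at height K |a|_1/n with K of order
ln n ([freq_sum_ge_large]).  If the small coordinates carry 9/10 of the l1
norm, then for them A >= 0.81 |a|_1^2/n and the Gaussian-type bound with
D = 1.3 delta ln n applies, with probability at least n^(-5 delta)/2.
Otherwise the large ones carry 1/10 of it, and being large they have
A >= K |a|_1^2/(10 n), which makes the required threshold a small multiple of
sqrt A, reached with constant probability.  In both cases the complementary
sum is nonnegative with probability at least p, independently.

For the remaining, bounded, values of n it is enough that every coordinate
exceeds tau b_i simultaneously, which has probability at least
(1/4 - tau)^n ([freq_sum_ge_pow]); here delta < 1/16 gives tau < 1/4. *)

(** * Averages over finite sets *)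

Section mean.
Variable R : realType.

Definition mean (T : finType) (F : T -> R) : R := (\sum_t F t) / #|T|%:R.

Lemma eq_mean (T : finType) (F G : T -> R) : F =1 G -> mean F = mean G.
Proof. by move=> FG; rewrite /mean (eq_bigr G). Qed.

Lemma meanD (T : finType) (F G : T -> R) :
  mean (fun t => F t + G t) = mean F + mean G.
Proof. by rewrite /mean big_split mulrDl. Qed.

Lemma meanZ (T : finType) (c : R) (F : T -> R) :
  mean (fun t => c * F t) = c * mean F.
Proof. by rewrite /mean -mulr_sumr mulrA. Qed.

Lemma mean_cst (T : finType) (c : R) : (0 < #|T|)%N -> mean (fun _ : T => c) = c.
Proof.
move=> T0; rewrite /mean sumr_const -[in X in X / _]mulr_natr mulfK//.
by rewrite pnatr_eq0 -lt0n.
Qed.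

Lemma le_mean (T : finType) (F G : T -> R) :
  (forall t, F t <= G t) -> mean F <= mean G.
Proof. by move=> FG; rewrite ler_wpM2r ?invr_ge0// ler_sum. Qed.

Lemma mean_ge0 (T : finType) (F : T -> R) : (forall t, 0 <= F t) -> 0 <= mean F.
Proof. by move=> F0; rewrite mulr_ge0 ?invr_ge0 ?sumr_ge0. Qed.

Definition freq (T : finType) (A : pred T) : R := mean (fun t => (A t)%:R).

Lemma le_freq (T : finType) (A B : pred T) :
  (forall t, A t -> B t) -> freq A <= freq B.
Proof.
move=> AB; apply: le_mean => t; rewrite ler_nat.
by case: (A t) (AB t) => // ->.
Qed.

Section product.
Variables (I J : finType).
Implicit Types (B : {set I}).

Lemma mean_prod (F : I -> J -> R) :
  mean (fun f : {ffun I -> J} => \prod_i F i (f i)) = \prod_i mean (F i).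
Proof.
rewrite /mean card_ffun natrX big_split/= prodr_const exprVn.
by congr (_ / _); rewrite (bigA_distr_bigA (fun i j => F i j)).
Qed.

Lemma mean_prod_in B (F : I -> J -> R) : (0 < #|J|)%N ->
  mean (fun f : {ffun I -> J} => \prod_(i in B) F i (f i)) =
  \prod_(i in B) mean (F i).
Proof.
move=> J0; rewrite [RHS]big_mkcond/=.
transitivity (\prod_i mean (fun j => if i \in B then F i j else 1)).
  by rewrite -mean_prod; apply: eq_mean => f; rewrite big_mkcond.
by apply: eq_bigr => i _; case: (i \in B) => //; rewrite mean_cst.
Qed.

Lemma mean_expR_sum B (x : I -> J -> R) (s : R) : (0 < #|J|)%N ->
  mean (fun f : {ffun I -> J} => expR (s * \sum_(i in B) x i (f i))) =
  \prod_(i in B) mean (fun j => expR (s * x i j)).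
Proof.
move=> J0; rewrite -mean_prod_in//; apply: eq_mean => f.
by rewrite mulr_sumr expR_sum.
Qed.

Definition splice B (f g : {ffun I -> J}) : {ffun I -> J} :=
  [ffun i => if i \in B then f i else g i].

(** If [F] depends only on the coordinates in [B] and [G] only on the others,
they are uncorrelated.  Exchanging between [f] and [g] their coordinates
outside [B] is an involution of the set of pairs, and [F f * G g] becomes a
product in which both factors are evaluated at the same point. *)
Lemma mean_indep B (F G : {ffun I -> J} -> R) : (0 < #|J|)%N ->
    (forall f g, F (splice B f g) = F f) ->
    (forall f g, G (splice B f g) = G g) ->
  mean (fun f => F f * G f) = mean F * mean G.
Proof.
move=> J0 hF hG.
have N0 : #|{ffun I -> J}|%:R != 0 :> R.
  by rewrite card_ffun pnatr_eq0 expn_eq0 negb_and -lt0n J0.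
pose theta (p : {ffun I -> J} * {ffun I -> J}) :=
  (splice B p.1 p.2, splice B p.2 p.1).
have thetaK : involutive theta.
  by move=> [f g]; rewrite /theta/=; congr pair; apply/ffunP => i;
    rewrite !ffunE; case: (i \in B).
have -> : mean F * mean G = (\sum_p F p.1 * G p.2) /
    (#|{ffun I -> J}|%:R * #|{ffun I -> J}|%:R).
  rewrite /mean mulrACA -invfM big_distrl/=; congr (_ / _).
  rewrite -(pair_big xpredT xpredT (fun f g => F f * G g))/=.
  by apply: eq_bigr => f _; rewrite big_distrr.
have -> : \sum_p F p.1 * G p.2 = \sum_p F (theta p).1 * G (theta p).1.
  by apply: eq_bigr => -[f g] _ /=; rewrite hF hG.
rewrite -(reindex_inj (inv_inj thetaK) (P := xpredT)
  (F := fun p => F p.1 * G p.1))/=.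
rewrite -(pair_big xpredT xpredT (fun f g => F f * G f))/=.
under eq_bigr do rewrite sumr_const -mulr_natr.
by rewrite -mulr_suml invfM mulrA mulfK.
Qed.
End product.

End mean.

(** * Quadratic bounds for the exponential near 0 *)

Section exp_bounds.
Variable R : realType.
Implicit Types x y : R.

Lemma le_of_slope_sign (h h' : R -> R) x :
    (forall y, is_derive y 1 h (h' y)) ->
    (forall y, `|y| <= `|x| -> 0 <= y * h' y) ->
  h 0 <= h x.
Proof.
move=> dh hs.
have ch (a b : R) : {within `[a, b], continuous h}.
  apply: continuous_subspaceT => y; apply: differentiable_continuous.
  by apply/derivable1_diffP; have := dh y => -[].
have [x0|x0|->//] := ltgtP x 0.
- have [c cx hc] := MVT x0 (fun y _ => dh y) (ch _ _).
  have /= := hs c; rewrite itv_boundlr/= in cx.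
  move: cx => /andP[]; rewrite ?bnd_simp => xc c0.
  rewrite !ler0_norm ?(ltW c0) ?(ltW x0)// lerN2 (ltW xc) => /(_ isT).
  by rewrite nmulr_rge0// => hc0; rewrite -subr_le0 hc; nra.
- have [c cx hc] := MVT x0 (fun y _ => dh y) (ch _ _).
  have /= := hs c; rewrite itv_boundlr/= in cx.
  move: cx => /andP[]; rewrite ?bnd_simp => c0 xc.
  rewrite !ger0_norm ?(ltW c0) ?(ltW x0)// (ltW xc) => /(_ isT).
  by rewrite pmulr_rge0// => hc0; rewrite -subr_ge0 hc; nra.
Qed.

(** The upper companion of [1 + x <= expR x], in the denominator-free form
that stays true for [1 <= x]. *)
Lemma expR_mul1B_le1 x : expR x * (1 - x) <= 1.
Proof.
have := expR_ge1Dx (- x); rewrite expRN => h.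
by rewrite mulrC -ler_pdivlMr ?expR_gt0// div1r.
Qed.

(** This bound and the next have second-order coefficient within 1% of 1/2.
Their difference with the exponential vanishes at 0, and first-order bounds
on [expR] already give the sign of its derivative. *)
Lemma expR_le_quad x : `|x| <= 200^-1 -> expR x <= 1 + x + 101 / 200 * x ^+ 2.
Proof.
move=> hx; rewrite -subr_ge0.
pose h (y : R) := 1 + y + 101 / 200 * y ^+ 2 - expR y.
pose h' (y : R) := 1 + 101 / 100 * y - expR y.
have -> : 0 = h 0 by rewrite /h expR0; ring.
apply: (@le_of_slope_sign h h').
  move=> y; rewrite /h; apply: is_derive_eq.
  by rewrite /h' !scaler1/= /GRing.scale/=; lra.
move=> y /le_trans/(_ hx) hy; rewrite /h'.
have e1 := expR_mul1B_le1 y; have e2 := expR_ge1Dx y.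
move: (hy); rewrite ler_norml => /andP[y1 y2].
have [y0|y0] := leP 0 y; last by nra.
apply: mulr_ge0 => //; rewrite subr_ge0 -(@ler_pM2r _ (1 - y)); last by lra.
by nra.
Qed.

Lemma expR_ge_quad x : `|x| <= 200^-1 -> 1 + x + 99 / 200 * x ^+ 2 <= expR x.
Proof.
move=> hx; rewrite -subr_ge0.
pose h (y : R) := expR y - (1 + y + 99 / 200 * y ^+ 2).
pose h' (y : R) := expR y - (1 + 99 / 100 * y).
have -> : 0 = h 0 by rewrite /h expR0; ring.
apply: (@le_of_slope_sign h h').
  move=> y; rewrite /h; apply: is_derive_eq.
  by rewrite /h' !scaler1/= /GRing.scale/=; lra.
move=> y /le_trans/(_ hx) hy; rewrite /h'.
have e1 := expR_mul1B_le1 y; have e2 := expR_ge1Dx y.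
move: (hy); rewrite ler_norml => /andP[y1 y2].
have [y0|y0] := leP 0 y; first by nra.
rewrite -mulrNN mulr_ge0 ?oppr_ge0 ?(ltW y0)// subr_le0.
rewrite -(@ler_pM2r _ (1 - y)); last by lra.
by nra.
Qed.

End exp_bounds.

(** * Moment generating functions and lower tail bounds *)

Section tails.
Variable R : realType.

(** The second moment is [b ^+ 2 / 2], not just at most that, because lower
tail bounds need a lower bound on the variance. *)
Definition spread (J : finType) (b : R) (x : J -> R) :=
  [/\ 0 <= b, mean x = 0, mean (fun j => x j ^+ 2) = b ^+ 2 / 2
    & forall j, `|x j| <= b].

Lemma mean_expR_bounds (J : finType) (b s : R) (x : J -> R) :
    (0 < #|J|)%N -> spread b x -> 0 <= s -> s * b <= 200^-1 ->
  expR (49 / 200 * (s ^+ 2 * b ^+ 2)) <= mean (fun j => expR (s * x j))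
    <= expR (101 / 400 * (s ^+ 2 * b ^+ 2)).
Proof.
move=> J0 [b0 x1 x2 xb] s0 sb.
have quad (c : R) : mean (fun j => 1 + s * x j + c * (s * x j) ^+ 2) =
    1 + c / 2 * (s ^+ 2 * b ^+ 2).
  rewrite meanD meanD mean_cst// !meanZ x1 mulr0 addr0.
  rewrite (eq_mean (G := fun j => s ^+ 2 * x j ^+ 2)) => [|j]; last first.
    by rewrite exprMn.
  by rewrite meanZ x2; congr (_ + _); field.
have small j : `|s * x j| <= 200^-1.
  by rewrite normrM (ger0_norm s0) (le_trans _ sb)// ler_wpM2l.
apply/andP; split; last first.
  apply: (le_trans (le_mean (fun j => expR_le_quad (small j)))).
  by rewrite quad (le_trans _ (expR_ge1Dx _))//; lra.
apply: (le_trans _ (le_mean (fun j => expR_ge_quad (small j)))).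
rewrite quad -exprMn; set y := (s * b) ^+ 2.
have y0 : 0 <= y by rewrite sqr_ge0.
have y1 : y <= 1 by rewrite /y expr_le1 ?mulr_ge0//; lra.
have := expR_mul1B_le1 (49 / 200 * y); set E := expR _ => hE.
have y2 : y <= 100^-1.
  have : s * b * (s * b) <= 200^-1 * 200^-1 by rewrite ler_pM ?mulr_ge0.
  by rewrite -expr2 -/y; lra.
rewrite -(@ler_pM2r _ (1 - 49 / 200 * y)); last by lra.
by nra.
Qed.

Section partial_sums.
Variables (I J : finType) (b : I -> R) (x : I -> J -> R).
Hypotheses (J0 : (0 < #|J|)%N) (xb : forall i, spread (b i) (x i)).
Implicit Types (B : {set I}) (s : R).

Definition psum B (f : {ffun I -> J}) : R := \sum_(i in B) x i (f i).

Lemma mean_expR_psum B s : 0 <= s -> (forall i, i \in B -> s * b i <= 200^-1) ->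
  expR (49 / 200 * (s ^+ 2 * \sum_(i in B) b i ^+ 2)) <=
    mean (fun f => expR (s * psum B f))
    <= expR (101 / 400 * (s ^+ 2 * \sum_(i in B) b i ^+ 2)).
Proof.
move=> s0 sb; rewrite mean_expR_sum// !mulr_sumr !expR_sum; apply/andP; split.
  apply: ler_prod => i iB; rewrite expR_ge0/=.
  by have /andP[] := mean_expR_bounds J0 (xb i) s0 (sb i iB).
apply: ler_prod => i iB; rewrite mean_ge0 => [|j]; last exact: expR_ge0.
by have /andP[] := mean_expR_bounds J0 (xb i) s0 (sb i iB).
Qed.

(** The measure tilted by [expR (l * Y)] lives mostly on [t <= Y <= u].  On
[Y < t] the weight [expR (l * Y)] is dominated by [expR (m * Y)] times a
constant, on [u < Y] by [expR ((l + h) * Y)] times a constant, and on the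
middle part it is at most [expR (l * u)]. *)
Lemma mean_expR_le_freq (T : finType) (Y : T -> R) (t u l m h : R) :
    0 <= m <= l -> 0 <= h ->
  mean (fun f => expR (l * Y f)) <=
    expR ((l - m) * t) * mean (fun f => expR (m * Y f)) +
    expR (l * u) * freq R (fun f => t <= Y f) +
    expR (- (h * u)) * mean (fun f => expR ((l + h) * Y f)).
Proof.
move=> /andP[m0 ml] h0; rewrite -!meanZ -!meanD; apply: le_mean => f.
have p1 := expR_ge0 ((l - m) * t); have p2 := expR_ge0 (l * u).
have p3 := expR_ge0 (- (h * u)); have p4 := expR_ge0 (m * Y f).
have p5 := expR_ge0 ((l + h) * Y f).
have [tY|Yt] := leP t (Y f); rewrite ?mulr1 ?mulr0.
  have [Yu|uY] := leP (Y f) u.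
    have : expR (l * Y f) <= expR (l * u).
      by rewrite ler_expR ler_wpM2l// (le_trans m0).
    by have := mulr_ge0 p1 p4; have := mulr_ge0 p3 p5; lra.
  have : expR (l * Y f) <= expR (- (h * u)) * expR ((l + h) * Y f).
    by rewrite -expRD ler_expR; nra.
  by have := mulr_ge0 p1 p4; lra.
have : expR (l * Y f) <= expR ((l - m) * t) * expR (m * Y f).
  by rewrite -expRD ler_expR; nra.
by have := mulr_ge0 p3 p5; lra.
Qed.

(** Let [t = sqrt (D A)].  In units of [t / A], the sum is tilted by 3, and
compared with the tilts 2 (for [Y < t]) and 4 (for [Y > 2 t]).  For a Gaussian
of variance [A / 2] the three terms would be [9D/4], [2D] and [2D] in the
exponent, so that the main one wins with room for the 2% errors in the moment
generating functions; the cost of undoing the tilt is [6 D], which leaves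
[6 - 2.205 = 3.795 = 759 / 200]. *)
Lemma freq_psum_gaussian B (D : R) : 20 <= D ->
    0 < \sum_(i in B) b i ^+ 2 ->
    (forall i, i \in B ->
      4 * Num.sqrt (D / \sum_(i in B) b i ^+ 2) * b i <= 200^-1) ->
  expR (- (759 / 200 * D)) / 2 <=
    freq R (fun f => Num.sqrt (D * \sum_(i in B) b i ^+ 2) <= psum B f).
Proof.
set A := \sum_(i in B) _ => D20 A0 small.
have D0 : 0 < D by lra.
set r := Num.sqrt (D / A).
have r0 : 0 < r by rewrite sqrtr_gt0 divr_gt0.
have r2 : r ^+ 2 * A = D by rewrite sqr_sqrtr ?divfK ?gt_eqF// ltW// divr_gt0.
have -> : Num.sqrt (D * A) = r * A.
  by rewrite -r2 -mulrA -expr2 -exprMn sqrtr_sqr ger0_norm// mulr_ge0// ltW.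
have sm (k : R) : 0 <= k <= 4 ->
    0 <= k * r /\ (forall i, i \in B -> (k * r) * b i <= 200^-1).
  move=> /andP[k0 k4]; split=> [|i iB]; first by rewrite mulr_ge0// ltW.
  apply: le_trans (small i iB); rewrite -/r !ler_wpM2r ?(ltW r0)//.
  by have [] := xb i.
have mg (k : R) : 0 <= k <= 4 -> expR (49 / 200 * (k ^+ 2 * D)) <=
    mean (fun f => expR (k * r * psum B f)) <= expR (101 / 400 * (k ^+ 2 * D)).
  move=> /sm[k0 ks]; have := mean_expR_psum k0 ks.
  by rewrite -/A exprMn -(mulrA (k ^+ 2)) r2.
have := @mean_expR_le_freq _ (psum B)
  (r * A) (2 * (r * A)) (3 * r) (2 * r) (1 * r).
have -> : 3 * r + 1 * r = 4 * r by ring.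
have -> : (3 * r - 2 * r) * (r * A) = D by rewrite -r2; ring.
have -> : 3 * r * (2 * (r * A)) = 6 * D by rewrite -r2; ring.
have -> : 1 * r * (2 * (r * A)) = 2 * D by rewrite -r2; ring.
set P := freq _ _; move=> /(_ _ _) H.
have {H} := H ltac:(apply/andP; split; nra) ltac:(nra).
have /andP[M3 _] := mg 3 ltac:(apply/andP; split; lra).
have /andP[_ M2] := mg 2 ltac:(apply/andP; split; lra).
have /andP[_ M4] := mg 4 ltac:(apply/andP; split; lra).
move: M2 M3 M4; set m2 := mean _; set m3 := mean _; set m4 := mean _ => M2 M3 M4 H.
have {M3} H : expR (49 / 200 * (3 ^+ 2 * D)) <=
    expR (D + 101 / 400 * (2 ^+ 2 * D)) + expR (6 * D) * P +
    expR (- (2 * D) + 101 / 400 * (4 ^+ 2 * D)).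
  apply: (le_trans M3); apply: (le_trans H); rewrite !expRD.
  by apply: lerD; first apply: lerD => //; rewrite ler_pM2l ?expR_gt0.
rewrite -(ler_pM2l (expR_gt0 (6 * D))).
have e1 : expR (D + 101 / 400 * (2 ^+ 2 * D)) <= expR (408 / 200 * D).
  by rewrite ler_expR; lra.
have e2 : expR (- (2 * D) + 101 / 400 * (4 ^+ 2 * D)) = expR (408 / 200 * D).
  by congr expR; field.
have e3 : expR (49 / 200 * (3 ^+ 2 * D)) =
    expR (408 / 200 * D) * expR (33 / 200 * D).
  by rewrite -expRD; congr expR; field.
have e4 : expR (6 * D) * (expR (- (759 / 200 * D)) / 2) =
    expR (408 / 200 * D) * expR (33 / 200 * D) / 2.
  by rewrite mulrA -!expRD; congr (expR _ / _); field.
have e5 : 4 <= expR (33 / 200 * D) by apply: le_trans (expR_ge1Dx _); lra.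
rewrite e4; have := expR_gt0 (408 / 200 * D); move: H; rewrite e2 e3.
by nra.
Qed.

End partial_sums.

(** The same tilting argument with [l] of order [1 / sqrt A] and [m = 0]: all
exponents are then constants, so the main term exceeds the other two by a
fixed amount as soon as [u] is a large multiple of [sqrt A].  No coordinate
exceeds [sqrt A], which is why every vector qualifies. *)
Lemma freq_psum_std : exists c p : R, [/\ 0 < c, 0 < p, p <= 1 &
  forall (I J : finType) (b : I -> R) (x : I -> J -> R) (B : {set I}),
    (0 < #|J|)%N -> (forall i, spread (b i) (x i)) ->
    p <= freq R (fun f => c * Num.sqrt (\sum_(i in B) b i ^+ 2) <= psum x B f)].
Proof.
(* [s / sqrt A] is the tilt, and [V * sqrt A / s] the level [u], so that
   undoing the tilt costs [expR V]. *)
have [s [s0 s1 s200]] : exists s : R, [/\ 0 < s, s <= 1 & 2 * s <= 200^-1].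
  by exists 400^-1; split; lra.
have q0 : 0 < s ^+ 2 by rewrite exprn_gt0.
have q1 : s ^+ 2 <= 1 by rewrite expr_le1 // ltW.
have [V qV] : exists V, s ^+ 2 * V = 25.
  by exists (25 / s ^+ 2); rewrite mulrCA divff ?mulr1// gt_eqF.
have V0 : 0 < V by rewrite -(pmulr_rgt0 _ q0) qV.
have V25 : 25 <= V by nra.
exists (s / 10), (s ^+ 2 / 10 * expR (- V)); split.
- by rewrite divr_gt0.
- by apply: mulr_gt0; [apply: divr_gt0 => //; lra|exact: expR_gt0].
- have : expR (- V) <= 1 by rewrite expR_le1; lra.
  have := expR_ge0 (- V); nra.
move=> I J b x B J0 xb; set A := \sum_(i in B) _.
have A0 : 0 <= A by apply: sumr_ge0 => i _; exact: sqr_ge0.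
have [Az|Apos] := eqVneq A 0.
  have b0 i : i \in B -> b i = 0.
    move: Az => /eqP; rewrite psumr_eq0 => [|j _]; last exact: sqr_ge0.
    move=> /allP/(_ i); rewrite mem_index_enum => /(_ isT)/implyP h /h.
    by rewrite sqrf_eq0 => /eqP.
  apply: (@le_trans _ _ (mean (fun _ : {ffun I -> J} => 1))); last first.
    apply: le_mean => f; rewrite Az sqrtr0 mulr0 /psum big1 ?lexx// => i iB.
    have [_ _ _ /(_ (f i))] := xb i; rewrite b0// normr_le0 => /eqP //.
  rewrite mean_cst ?card_ffun ?expn_gt0 ?J0//.
  have : expR (- V) <= 1 by rewrite expR_le1; lra.
  by have := expR_ge0 (- V); nra.
have {}Apos : 0 < A by rewrite lt_neqAle eq_sym Apos.
set r := Num.sqrt A; have r0 : 0 < r by rewrite sqrtr_gt0.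
have r2 : r ^+ 2 = A by rewrite sqr_sqrtr.
have br i : i \in B -> b i <= r.
  move=> iB; have [b0 _ _ _] := xb i.
  rewrite -(ler_sqr b0 (ltW r0))// r2 /A (bigD1 i)//= lerDl sumr_ge0// => j _.
  exact: sqr_ge0.
have mg (k : R) : 0 <= k <= 2 -> expR (49 / 200 * (k ^+ 2 * s ^+ 2)) <=
    mean (fun f => expR (k * s / r * psum x B f))
    <= expR (101 / 400 * (k ^+ 2 * s ^+ 2)).
  move=> /andP[k0 k2].
  have e : k ^+ 2 * s ^+ 2 = (k * s / r) ^+ 2 * A.
    by rewrite -r2 -[RHS]exprMn divfK ?gt_eqF// exprMn.
  rewrite e; apply: mean_expR_psum => // [|i iB].
    by rewrite divr_ge0 ?mulr_ge0// ltW.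
  rewrite mulrAC ler_pdivrMr//; apply: (@le_trans _ _ (k * s * r)).
    by rewrite ler_wpM2l ?br// mulr_ge0// ltW.
  by rewrite ler_wpM2r ?(ltW r0)//; nra.
have := @mean_expR_le_freq _ (psum x B)
  (s / 10 * r) (V * r / s) (1 * s / r) 0 (1 * s / r).
have -> : 1 * s / r + 1 * s / r = 2 * s / r by ring.
have -> : (1 * s / r - 0) * (s / 10 * r) = s ^+ 2 / 10 by field; rewrite gt_eqF.
have -> : 1 * s / r * (V * r / s) = V by field; rewrite !gt_eqF.
set P := freq _ _; move=> /(_ _ _) H.
have sr0 : 0 <= 1 * s / r by rewrite divr_ge0 ?mulr_ge0// ltW.
have {H} := H ltac:(by rewrite lexx) sr0.
have -> : mean (fun f => expR (0 * psum x B f)) = 1.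
  rewrite -[RHS](@mean_cst R {ffun I -> J}) ?card_ffun ?expn_gt0 ?J0//.
  by apply: eq_mean => f; rewrite mul0r expR0.
have /andP[M1 _] := mg 1 ltac:(apply/andP; split; lra).
have /andP[_ M2] := mg 2 ltac:(apply/andP; split; lra).
move: M1 M2; set m1 := mean _; set m2 := mean _ => M1 M2 H.
have e1 : expR (s ^+ 2 / 10) * (1 + 29 / 200 * s ^+ 2) <= m1.
  apply: le_trans M1.
  apply: (@le_trans _ _ (expR (s ^+ 2 / 10) * expR (29 / 200 * s ^+ 2))).
    by rewrite ler_pM2l ?expR_gt0 ?expR_ge1Dx.
  by rewrite -expRD ler_expR; lra.
have e2 : expR (- V) * m2 <= expR (- (V - 2)).
  apply: (@le_trans _ _ (expR (- V) * expR 2)); last by rewrite -expRD ler_expR; lra.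
  rewrite ler_pM2l ?expR_gt0//; apply: le_trans M2 _; rewrite ler_expR; lra.
have e3 : expR (- (V - 2)) <= 9 / 200 * s ^+ 2.
  have V2 := expR_ge1Dx (V - 2).
  rewrite expRN -div1r ler_pdivrMr ?expR_gt0//; move: V2; set E := expR _ => V2.
  have : s ^+ 2 * (1 + (V - 2)) <= s ^+ 2 * E by rewrite ler_pM2l.
  by lra.
have e4 : 1 <= expR (s ^+ 2 / 10) by apply: le_trans (expR_ge1Dx _); lra.
rewrite expRN -[X in _ <= X](mulKf (lt0r_neq0 (expR_gt0 V))) mulrC.
rewrite ler_pM2l ?invr_gt0 ?expR_gt0//.
by nra.
Qed.

End tails.

(** * The tail bound for finitely valued coordinates *)

Section finite_model.
Variable R : realType.

Section one_vector.
Variables (I J : finType) (b : I -> R) (x : I -> J -> R).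
Hypotheses (J0 : (0 < #|J|)%N) (xb : forall i, spread (b i) (x i)).

Let b_ge0 i : 0 <= b i. Proof. by have [] := xb i. Qed.

(** With [y = x i j / b i], which lies in [[-1, 1]] and has mean 0 and second
moment 1/2, the indicator of [tau <= y] is at least [(y ^+ 2 + y) / 2 - tau];
the average of the latter is [1/4 - tau]. *)
Lemma freq_coordinate_ge i (tau : R) : 0 <= tau <= 1 ->
  4^-1 - tau <= freq R (fun j => tau * b i <= x i j).
Proof.
move=> /andP[t0 t1]; have [_ x1 x2 xle] := xb i.
have [bz|bn] := eqVneq (b i) 0.
  apply: (@le_trans _ _ (mean (fun _ : J => 1))); first by rewrite mean_cst//; lra.
  apply: le_mean => j; have := xle j; rewrite bz normr_le0 => /eqP ->.
  by rewrite mulr0 lexx.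
have bp : 0 < b i by rewrite lt_neqAle eq_sym bn b_ge0.
have -> : 4^-1 - tau =
    mean (fun j => (2 * b i ^+ 2)^-1 * x i j ^+ 2 +
                   ((2 * b i)^-1 * x i j + - tau)).
  by rewrite !meanD !meanZ mean_cst// x1 x2; field; rewrite gt_eqF.
apply: le_mean => j; have xj := xle j.
have {xj} : `|x i j / b i| <= 1.
  by rewrite normrM normfV (gtr0_norm bp) ler_pdivrMr// mul1r.
have -> : (tau * b i <= x i j) = (tau <= x i j / b i) by rewrite ler_pdivlMr.
have -> : (2 * b i ^+ 2)^-1 * x i j ^+ 2 + ((2 * b i)^-1 * x i j + - tau) =
  ((x i j / b i) ^+ 2 + x i j / b i) / 2 - tau by field; rewrite gt_eqF.
set y := x i j / b i; rewrite ler_norml => /andP[y1 y2].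
have [ty|yt] := leP tau y; rewrite ?mulr1n ?mulr0n; first by nra.
by have [y0|y0] := leP 0 y; nra.
Qed.

Lemma freq_sum_ge_pow (tau : R) : 0 <= tau <= 4^-1 ->
  (4^-1 - tau) ^+ #|I| <=
    freq R (fun f : {ffun I -> J} => tau * \sum_i b i <= \sum_i x i (f i)).
Proof.
move=> /andP[t0 t1].
apply: (@le_trans _ _ (mean (fun f : {ffun I -> J} =>
    \prod_i (tau * b i <= x i (f i))%R%:R))).
  rewrite (mean_prod (fun i j => (tau * b i <= x i j)%R%:R)) -prodr_const.
  apply: ler_prod => i _; rewrite subr_ge0 t1/=; apply: freq_coordinate_ge.
  by rewrite t0/=; lra.
apply: le_mean => f; rewrite mulr_sumr.
have [h|] := boolP [forall i, tau * b i <= x i (f i)].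
  rewrite ler_sum => [|i _]; last exact: (forallP h).
  by apply: prodr_ile1 => i _; rewrite ler0n/= lern1 leq_b1.
rewrite negb_forall => /existsP[i /negbTE hi].
by rewrite (bigD1 i)//= hi mul0r ler0n.
Qed.

Lemma freq_sum_ge_split (B : {set I}) (t t1 t2 q1 q2 : R) :
    t <= t1 + t2 -> 0 <= q1 -> 0 <= q2 ->
    q1 <= freq R (fun f => t1 <= psum x B f) ->
    q2 <= freq R (fun f => t2 <= psum x (~: B) f) ->
  q1 * q2 <= freq R (fun f : {ffun I -> J} => t <= \sum_i x i (f i)).
Proof.
move=> tt q10 q20 h1 h2; apply: le_trans (ler_pM q10 q20 h1 h2) _.
rewrite /freq -(mean_indep (B := B))//; first last.
- move=> f g; congr (nat_of_bool (_ <= _))%:R; apply: eq_bigr => i.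
  by rewrite inE ffunE => /negbTE ->.
- move=> f g; congr (nat_of_bool (_ <= _))%:R; apply: eq_bigr => i iB.
  by rewrite ffunE iB.
apply: le_mean => f; rewrite -natrM mulnb ler_nat (bigID (mem B))/=.
case: (boolP (_ && _)) => // /andP[p1 p2]; rewrite lt0b.
apply: le_trans tt _; apply: lerD => //; rewrite /psum in p2.
by rewrite (eq_bigl (mem (~: B))) => [//|i]; rewrite !inE.
Qed.

End one_vector.

(** Here [L] stands for [ln #|I|]; keeping it abstract confines the growth of
the logarithm to the hypothesis [1000 ^+ 2 * (D * K ^+ 2) <= #|I|%:R], which
says that coordinates below the cut [K N / n] are small enough for
[freq_psum_gaussian].  [K] is chosen so that the threshold is at most
[c * sqrt A] whenever the coordinates above the cut carry a tenth of [N]. *)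
Lemma freq_sum_ge_large (delta c p L : R)
    (I J : finType) (b : I -> R) (x : I -> J -> R) :
    0 < delta -> 0 < c -> 0 < p -> p <= 1 ->
    (forall B : {set I},
      p <= freq R (fun f =>
        c * Num.sqrt (\sum_(i in B) b i ^+ 2) <= psum x B f)) ->
    (0 < #|I|)%N -> (0 < #|J|)%N -> (forall i, spread (b i) (x i)) ->
  let D := 13 / 10 * delta * L in let K := 21 / 2 * delta * L / c ^+ 2 in
    20 <= D -> 1000 ^+ 2 * (D * K ^+ 2) <= #|I|%:R ->
  p ^+ 2 / 2 * expR (- (5 * delta * L)) <=
    freq R (fun f : {ffun I -> J} =>
      Num.sqrt (21 / 20 * delta * L / #|I|%:R) * \sum_i b i <= \sum_i x i (f i)).
Proof.
move=> delta0 c0 p0 p1 std I0 J0 xb D K D20 nK.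
have b0 i : 0 <= b i by have [] := xb i.
set N := \sum_i b i; have N0 : 0 <= N by exact: sumr_ge0.
set n : R := #|I|%:R in nK *; have n0 : 0 < n by rewrite ltr0n.
have dL0 : 0 < delta * L by rewrite /D in D20; nra.
have c20 : 0 < c ^+ 2 by rewrite exprn_gt0.
have K0 : 0 < K by rewrite /K divr_gt0// -mulrA mulr_gt0.
have e0 := expR_gt0 (- (5 * delta * L)).
have e1 : expR (- (5 * delta * L)) <= 1 by rewrite expR_le1; lra.
have tN : Num.sqrt (21 / 20 * delta * L / n) * N =
    Num.sqrt (21 / 20 * (delta * L) * N ^+ 2 / n).
  rewrite -[in LHS](ger0_norm N0) -sqrtr_sqr -sqrtrM; last first.
    by rewrite divr_ge0// ?ltW//; lra.
  by congr Num.sqrt; ring.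
rewrite tN {tN}.
have [Nz|Nn] := eqVneq N 0.
  rewrite Nz expr0n/= mulr0 mul0r sqrtr0.
  apply: (@le_trans _ _ p); first by nra.
  apply: le_trans (std [set: I]%SET) _; apply: le_freq => f /(le_trans _) h.
  rewrite (eq_bigl (mem [set: I]%SET)) => [|i]; last by rewrite !inE.
  by apply: h; rewrite mulr_ge0 ?sqrtr_ge0 ?ltW.
have {Nn}N0 : 0 < N by rewrite lt_neqAle eq_sym Nn N0.
pose S := [set i | b i <= K * N / n]%SET.
have NS : N = \sum_(i in S) b i + \sum_(i in ~: S) b i.
  rewrite /N (bigID (mem S))/=; congr (_ + _).
  by apply: eq_bigl => i; rewrite !inE.
have A0 B : 0 <= \sum_(i in B) b i ^+ 2 by apply: sumr_ge0 => i _; exact: sqr_ge0.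
have [small|large] := leP (9 / 10 * N) (\sum_(i in S) b i).
- set A := \sum_(i in S) b i ^+ 2.
  have A1 : 81 / 100 * N ^+ 2 <= n * A.
    (* Cauchy-Schwarz: the variance of [b] about the mean value [q] that the
       l1 norm forces is nonnegative. *)
    pose q := 9 / 10 * N / n.
    have : 0 <= \sum_(i in S) (b i - q) ^+ 2.
      by apply: sumr_ge0 => i _; exact: sqr_ge0.
    have -> : \sum_(i in S) (b i - q) ^+ 2 =
        A - 2 * q * \sum_(i in S) b i + q ^+ 2 * #|S|%:R.
      rewrite /A mulr_sumr -sumrB mulr_natr -sumr_const -big_split/=.
      by apply: eq_bigr => i _; ring.
    have Sn : #|S|%:R <= n by rewrite ler_nat max_card.
    have qn : q * n = 9 / 10 * N by rewrite /q divfK ?gt_eqF.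
    have q0 : 0 < q by rewrite divr_gt0//; lra.
    move: small Sn; set sb := \sum_(i in S) b i.
    set sn := #|S|%:R => h1 h2 h3.
    have h4 : q ^+ 2 * sn <= q * (9 / 10 * N).
      by rewrite -qn expr2 -mulrA !ler_pM2l.
    have h5 : q * (9 / 10 * N) <= q * sb by rewrite ler_pM2l.
    have h6 : q * (9 / 10 * N) <= A by lra.
    have := congr1 (fun z => z * (9 / 10 * N)) qn.
    by have := ler_wpM2l (ltW n0) h6; lra.
  have N20 : 0 < N ^+ 2 by rewrite exprn_gt0.
  have Ap : 0 < A by rewrite -(pmulr_rgt0 _ n0); lra.
  have r2 : Num.sqrt (D / A) ^+ 2 * A = D.
    by rewrite sqr_sqrtr ?divfK ?gt_eqF// divr_ge0 ?(ltW Ap)//; lra.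
  have tails i : i \in S -> 4 * Num.sqrt (D / A) * b i <= 200^-1.
    rewrite inE => biK; move: r2; have := sqrtr_ge0 (D / A).
    set r := Num.sqrt (D / A) => r0 r2.
    have y0 : 0 <= r * b i by rewrite mulr_ge0.
    have h1 : (r * b i) ^+ 2 * (81 / 100 * N ^+ 2) * n <= (D * K ^+ 2) * N ^+ 2.
      have h2 : (r * b i) ^+ 2 * (81 / 100 * N ^+ 2) <=
          (r * b i) ^+ 2 * (n * A).
        by rewrite ler_wpM2l ?sqr_ge0.
      have h3 : (b i * n) ^+ 2 <= (K * N) ^+ 2.
        rewrite ler_sqr ?nnegrE; first by rewrite -ler_pdivlMr.
        - by rewrite mulr_ge0// ltW.
        - by rewrite mulr_ge0// ltW.
      have h4 : D * (b i * n) ^+ 2 <= D * (K * N) ^+ 2.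
        by rewrite ler_wpM2l//; lra.
      have h5 : (r * b i) ^+ 2 * (n * A) * n = D * (b i * n) ^+ 2.
        by rewrite -r2; ring.
      have h6 := ler_wpM2r (ltW n0) h2.
      apply: (le_trans h6); rewrite h5; apply: (le_trans h4).
      by rewrite exprMn mulrA.
    have h7 : (r * b i) ^+ 2 * (81 / 100 * n) <= D * K ^+ 2.
      by rewrite -(ler_pM2r N20); lra.
    have h8 : 1000 ^+ 2 * ((r * b i) ^+ 2 * (81 / 100)) <= 1.
      by rewrite -(ler_pM2r n0) mul1r; lra.
    have h9 : 800 * (r * b i) <= 1.
      have y8 : 0 <= 800 * (r * b i) by lra.
      rewrite -(@expr_le1 _ 2 _ isT y8).
      by rewrite exprMn; have := sqr_ge0 (r * b i); lra.
    by lra.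
  have := freq_psum_gaussian J0 xb D20 Ap tails; rewrite -/A => tailS.
  apply: le_trans (freq_sum_ge_split J0 _ _ (ltW p0) tailS (std (~: S))).
  - have : expR (- (5 * delta * L)) <= expR (- (759 / 200 * D)).
      by rewrite ler_expR /D; lra.
    move: e0; set e := expR (- (5 * delta * L)); set e' := expR (- _) => e0' ee'.
    have : p * (p * e) <= 1 * (p * e) by rewrite ler_wpM2r// mulr_ge0// ltW.
    have : p * e <= p * e' by rewrite ler_pM2l.
    by lra.
  - apply: (@le_trans _ _ (Num.sqrt (D * A))); last first.
      by rewrite lerDl mulr_ge0 ?sqrtr_ge0 ?ltW.
    rewrite ler_wsqrtr// ler_pdivrMr// /D.
    have := mulr_ge0 (ltW dL0) (ltW N20).
    by have := ler_wpM2l (ltW dL0) A1; lra.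
  - by rewrite divr_ge0 ?expR_ge0.
- set A := \sum_(i in ~: S) b i ^+ 2.
  have A1 : K * N ^+ 2 / n <= 10 * A.
    have A2 : (K * N / n) * \sum_(i in ~: S) b i <= A.
      rewrite mulr_sumr ler_sum// => i; rewrite !inE -ltNge => /ltW Kb.
      by rewrite expr2 ler_wpM2r.
    have A3 : N / 10 <= \sum_(i in ~: S) b i by move: NS large; lra.
    have k0 : 0 <= K * N / n by apply: divr_ge0; [apply: mulr_ge0|]; exact: ltW.
    by have := ler_wpM2l k0 A3; lra.
  have Kc : K * c ^+ 2 = 21 / 2 * delta * L by rewrite /K divfK ?gt_eqF.
  apply: le_trans
    (freq_sum_ge_split J0 _ (ltW p0) (ltW p0) (std S) (std (~: S))).
    by nra.
  apply: (@le_trans _ _ (c * Num.sqrt A)); last first.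
    by rewrite lerDr mulr_ge0 ?sqrtr_ge0 ?ltW.
  have -> : c * Num.sqrt A = Num.sqrt (c ^+ 2 * A).
    by rewrite sqrtrM ?sqr_ge0// sqrtr_sqr ger0_norm// ltW.
  rewrite ler_wsqrtr//.
  have := ler_wpM2l (ltW c20) A1.
  have -> : c ^+ 2 * (K * N ^+ 2 / n) = K * c ^+ 2 * N ^+ 2 / n by ring.
  by rewrite Kc; lra.
Qed.

(** The threshold [tau] depends only on [n] and [delta], and the bound holds
for every size of [J]: the circle is approximated by letting [#|J|] grow, and
the gap between [tau] and the square root pays for the approximation. *)
Theorem freq_sum_ge_pow_card (delta : R) : 0 < delta < 16^-1 ->
  exists2 C : R, 0 < C & forall n : nat, (0 < n)%N ->
  exists2 tau : R, Num.sqrt (delta * ln n%:R / n%:R) < tau &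
  forall (I J : finType) (b : I -> R) (x : I -> J -> R),
    #|I| = n -> (0 < #|J|)%N -> (forall i, spread (b i) (x i)) ->
  C / n%:R `^ (5 * delta) <=
    freq R (fun f : {ffun I -> J} => tau * \sum_i b i <= \sum_i x i (f i)).
Proof.
move=> /andP[delta0 delta16].
have [c [p [c0 p0 p1 std]]] := @freq_psum_std R.
(* With [L = ln n], the smallness condition of [freq_sum_ge_large] reads
   [k * L ^+ 3 <= expR L]; it follows from [(L / 4) ^+ 4 <= expR L] once
   [256 * k <= L]. *)
have [k [k0 kE]] : exists k : R, 0 <= k /\ forall L,
    1000 ^+ 2 * (13 / 10 * delta * L * (21 / 2 * delta * L / c ^+ 2) ^+ 2) =
    k * L ^+ 3.
  exists (1000 ^+ 2 * (13 / 10 * delta * (21 / 2 * delta / c ^+ 2) ^+ 2)); split.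
    apply: mulr_ge0; first exact: sqr_ge0.
    by apply: mulr_ge0; [lra|exact: sqr_ge0].
  by move=> L; field; rewrite gt_eqF.
have [L0 [L01 L0D L0k]] : exists L0 : R,
    [/\ 1 <= L0, 20 <= 13 / 10 * delta * L0 & 256 * k <= L0].
  have d0 : 0 < 13 / 10 * delta by lra.
  have d1 : 0 < 20 / (13 / 10 * delta) by apply: divr_gt0 => //; lra.
  exists (1 + 20 / (13 / 10 * delta) + 256 * k); split; [lra| |lra].
  rewrite !mulrDr mulrCA divff ?mulr1 ?gt_eqF//.
  by have := mulr_ge0 (ltW d0) k0; lra.
have sd : Num.sqrt delta < 4^-1.
  have -> : 4^-1 = Num.sqrt (16^-1) :> R.
    have -> : 16^-1 = (4^-1) ^+ 2 :> R by field.
    by rewrite sqrtr_sqr ger0_norm//; lra.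
  by rewrite ltr_sqrt//; lra.
pose rho := (4^-1 - Num.sqrt delta) / 2.
have sd0 := sqrtr_ge0 delta.
have rho0 : 0 < rho by rewrite /rho; lra.
have rho1 : rho <= 1 by rewrite /rho; lra.
pose N := Num.bound (expR L0).
exists (p ^+ 2 / 2 * rho ^+ N).
  have p20 : 0 < p ^+ 2 by rewrite exprn_gt0.
  by apply: mulr_gt0; [lra|rewrite exprn_gt0].
move=> n n0; have nR : 1 <= n%:R :> R by rewrite ler1n.
have nR0 : 0 < n%:R :> R by rewrite ltr0n.
have dpow : n%:R `^ (5 * delta) = expR (5 * delta * ln n%:R).
  by rewrite /powR (gt_eqF nR0).
have rN : 0 <= rho ^+ N <= 1 by rewrite exprn_ge0 ?exprn_ile1// ltW.
have lnn : 0 <= ln n%:R :> R by rewrite ln_ge0.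
have [large|small] := leP L0 (ln n%:R).
- set L := ln n%:R in large *.
  have L1 : 1 <= L by lra.
  exists (Num.sqrt (21 / 20 * delta * L / n%:R)).
    have dL : 0 < delta * L by rewrite mulr_gt0//; lra.
    rewrite ltr_sqrt; last by apply: divr_gt0 => //; lra.
    by rewrite ltr_pM2r ?invr_gt0//; lra.
  move=> I J b x In J0 xb; rewrite -In.
  apply: le_trans
    (freq_sum_ge_large (L := L) delta0 c0 p0 p1 _ _ J0 xb _ _).
  - rewrite In dpow -expRN.
    by rewrite -/L ler_wpM2r ?expR_ge0//; have := sqr_ge0 p; nra.
  - by move=> B; exact: std.
  - by rewrite In.
  - by apply: le_trans L0D _; rewrite ler_pM2l//; lra.
  - rewrite In kE.
    have -> : n%:R = expR L by rewrite lnK// posrE.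
    have -> : L = 4%:R * (L / 4) by field.
    rewrite expRM_natl.
    have h : L / 4 <= expR (L / 4) by apply: le_trans (expR_ge1Dx _); lra.
    have : (L / 4) ^+ 4 <= expR (L / 4) ^+ 4.
      by rewrite ler_pXn2r ?nnegrE ?expR_ge0//; lra.
    apply: le_trans.
    have -> : (L / 4) ^+ 4 = L / 256 * L ^+ 3 by field.
    have -> : 4 * (L / 4) = L by field.
    by rewrite ler_wpM2r ?exprn_ge0//; lra.
- exists (4^-1 - rho).
    apply: (@le_lt_trans _ _ (Num.sqrt delta)); last by rewrite /rho; lra.
    rewrite ler_wsqrtr// ler_pdivrMr// ler_pM2l//.
    by rewrite ltW// ln_sublinear.
  move=> I J b x In J0 xb.
  apply: (@le_trans _ _ (rho ^+ N)).
    rewrite ler_pdivrMr ?powR_gt0//.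
    have : 1 <= n%:R `^ (5 * delta).
      rewrite dpow; apply: le_trans (expR_ge1Dx _); rewrite lerDl.
      by apply: mulr_ge0 => //; lra.
    have : p ^+ 2 <= 1 by rewrite expr_le1// ltW.
    by have := sqr_ge0 p; nra.
  apply: (@le_trans _ _ (rho ^+ n)).
    rewrite ler_wiXn2l ?(ltW rho0)// -(ler_nat R).
    have : n%:R < expR L0 by rewrite -[n%:R]lnK ?posrE// ltr_expR.
    by move=> /ltW/le_trans; apply; rewrite ltW// archi_boundP// expR_ge0.
  have -> : rho ^+ n = (4^-1 - (4^-1 - rho)) ^+ #|I| by rewrite In opprB addrC subrK.
  by apply: freq_sum_ge_pow => //; rewrite /rho; lra.
Qed.
End finite_model.

(** * Roots of unity and arcs of the circle *)

Section roots_of_unity.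
Variable R : realType.
Local Open Scope complex_scope.
Local Notation normc := ComplexField.Normc.normc.
Local Notation Re := complex.Re.
Local Notation Im := complex.Im.
Implicit Types (z w : R[i]) (theta phi : R).

Lemma expiD theta phi : expi (theta + phi) = expi theta * expi phi.
Proof. by rewrite /expi cosD sinD; congr Complex; rewrite addrC. Qed.

Lemma expi0 : expi 0 = 1 :> R[i].
Proof. by rewrite /expi cos0 sin0. Qed.

Lemma expiMn theta n : expi (n%:R * theta) = expi theta ^+ n.
Proof.
elim: n => [|n IH]; first by rewrite mul0r expi0 expr0.
by rewrite -natr1 mulrDl mul1r expiD IH exprSr.
Qed.

Lemma normc_expi theta : normc (expi theta) = 1.
Proof. by rewrite /normc/= cos2Dsin2 sqrtr1. Qed.

Lemma sqr_normc z : normc z ^+ 2 = Re z ^+ 2 + Im z ^+ 2.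
Proof. by case: z => u v; rewrite sqr_sqrtr// addr_ge0 ?sqr_ge0. Qed.

Lemma normc_ge0 z : 0 <= normc z.
Proof. by case: z => u v; exact: sqrtr_ge0. Qed.

Lemma normr_Re_le z : `|Re z| <= normc z.
Proof.
rewrite -(ler_sqr (normr_ge0 _) (normc_ge0 _)) sqr_normc real_normK ?num_real//.
by rewrite lerDl sqr_ge0.
Qed.

Lemma Re_sqr z : Re z ^+ 2 = (normc z ^+ 2 + Re (z ^+ 2)) / 2.
Proof.
by rewrite sqr_normc; case: z => u v; rewrite [in Re (_ ^+ 2)]expr2/=; field.
Qed.

Lemma Re_sum (I : finType) (F : I -> R[i]) : Re (\sum_i F i) = \sum_i Re (F i).
Proof.
by rewrite (big_morph (@complex.Re R) (id1 := 0) (op1 := +%R))// => -[? ?] [? ?].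
Qed.

Section arc_centers.
Variables (m : nat) (m3 : (3 <= m)%N).

Let mR : 0 < m%:R :> R. Proof. by rewrite ltr0n; case: m m3. Qed.

Lemma omega_expn : omega R m ^+ m = 1.
Proof.
rewrite /omega -expiMn mulrC divfK ?gt_eqF// /expi mulrC mulr_natr.
by rewrite cos2pi sin2pi.
Qed.

Lemma Im_omega_gt0 : 0 < Im (omega R m).
Proof.
rewrite /omega/= sin_gt0_pi// divr_gt0 ?mulr_gt0 ?pi_gt0//=.
rewrite ltr_pdivrMr// mulrC ltr_pM2l ?pi_gt0// ltr_nat.
exact: leq_trans m3.
Qed.

Lemma sum_omega_expn (k : nat) : omega R m ^+ k != 1 ->
  \sum_(j < m) (omega R m ^+ k) ^+ j = 0.
Proof.
move=> q1; have := subrX1 (omega R m ^+ k) m.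
rewrite -exprM mulnC exprM omega_expn expr1n subrr => /esym/eqP.
by rewrite mulf_eq0 subr_eq0 (negbTE q1) => /eqP.
Qed.

Lemma omega_neq1 : omega R m != 1.
Proof. by apply/eqP => h; have := Im_omega_gt0; rewrite h ltxx. Qed.

Lemma omega_sqr_neq1 : omega R m ^+ 2 != 1.
Proof.
rewrite sqrf_eq1 (negbTE omega_neq1)/=; apply/eqP => h.
by have := Im_omega_gt0; rewrite h/= oppr0 ltxx.
Qed.

(** The rotated [m]-th roots of unity: with [phi = 0] the points of [Omega],
with [phi = pi / m] the midpoints of the arcs that these cut out. *)
Definition center phi (j : 'I_m) : R[i] := expi (phi + 2 * pi / m%:R * j%:R).

Lemma centerE phi j : center phi j = expi phi * omega R m ^+ j.
Proof. by rewrite /center expiD [in RHS]/omega -expiMn [j%:R * _]mulrC. Qed.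

(** Since [Re w ^+ 2 = (|w| ^+ 2 + Re (w ^+ 2)) / 2], the first two moments are
governed by the sums of the centers and of their squares, both of which vanish
because neither [omega] nor its square is 1. *)
Lemma spread_center phi (c : R[i]) :
  spread (normc c) (fun j => Re (c * center phi j)).
Proof.
have sum1 : \sum_j center phi j = 0.
  under eq_bigr do rewrite centerE.
  rewrite -mulr_sumr; have := @sum_omega_expn 1; rewrite expr1.
  move=> ->; last exact: omega_neq1.
  by rewrite mulr0.
have sum2 : \sum_j center phi j ^+ 2 = 0.
  under eq_bigr do rewrite centerE exprMn exprAC.
  by rewrite -mulr_sumr sum_omega_expn ?mulr0// omega_sqr_neq1.
split; first exact: normc_ge0.
- by rewrite /mean -Re_sum -mulr_sumr sum1 mulr0 mul0r.
- rewrite /mean; under eq_bigr do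
    rewrite Re_sqr ComplexField.Normc.normcM normc_expi mulr1 exprMn.
  rewrite -mulr_suml big_split/= sumr_const card_ord -Re_sum -mulr_sumr sum2.
  rewrite mulr0 addr0.
  by rewrite -mulr_natr; field; rewrite gt_eqF.
- move=> j; apply: le_trans (normr_Re_le _) _.
  by rewrite ComplexField.Normc.normcM normc_expi mulr1.
Qed.

Definition dot z w : R := Re z * Re w + Im z * Im w.

Lemma dot_expi theta phi : dot (expi theta) (expi phi) = cos (theta - phi).
Proof. by rewrite cosB. Qed.

(** Among the centers, the one whose arc contains [expi theta] is the nearest.
The difference of the two cosines is a product of two sines, whose arguments
have absolute values in the open interval from 0 to [pi] and opposite
signs. *)
Lemma dot_center_lt phi (j k : 'I_m) theta : k != j ->
    `|theta - (phi + 2 * pi / m%:R * j%:R)| < pi / m%:R ->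
  dot (expi theta) (center phi k) < dot (expi theta) (center phi j).
Proof.
move=> kj; rewrite !dot_expi.
set al := theta - (phi + _ * j%:R); rewrite ltr_norml => /andP[al1 al2].
set h := pi / m%:R in al1 al2 *.
have h0 : 0 < h by rewrite divr_gt0 ?pi_gt0.
have hm : m%:R * h = pi by rewrite /h mulrC divfK ?gt_eqF.
pose l : R := k%:R - j%:R.
have -> : theta - (phi + 2 * pi / m%:R * k%:R) = (al - h * l) - h * l.
  by rewrite /al /l /h; ring.
have {2}-> : al = (al - h * l) + h * l by ring.
rewrite -subr_gt0 cosB cosD.
have -> : cos (al - h * l) * cos (h * l) - sin (al - h * l) * sin (h * l) -
  (cos (al - h * l) * cos (h * l) + sin (al - h * l) * sin (h * l)) =
  - (2 * (sin (al - h * l) * sin (h * l))) by ring.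
have jm : (j%:R + 1 <= m%:R :> R) by rewrite natr1 ler_nat.
have km : (k%:R + 1 <= m%:R :> R) by rewrite natr1 ler_nat.
have j0 : 0 <= j%:R :> R by [].
have k0 : 0 <= k%:R :> R by [].
have [jk|jk|/val_inj jk] := ltngtP j k; last by rewrite jk eqxx in kj.
- have l1 : 1 <= l by rewrite /l lerBrDr addrC natr1 ler_nat.
  have l2 : l + 1 <= m%:R by rewrite /l; lra.
  have hl1 : h <= h * l by nra.
  have hl2 : h * l + h <= pi by rewrite -hm; nra.
  have s1 : 0 < sin (h * l) by apply: sin_gt0_pi; apply/andP; split; lra.
  have s2 : 0 < sin (h * l - al) by apply: sin_gt0_pi; apply/andP; split; lra.
  by rewrite -(opprB (h * l)) sinN; have := mulr_gt0 s1 s2; lra.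
- have l1 : 1 <= - l by rewrite /l opprB lerBrDr addrC natr1 ler_nat.
  have l2 : - l + 1 <= m%:R by rewrite /l; lra.
  have hl1 : h <= - (h * l) by nra.
  have hl2 : - (h * l) + h <= pi by rewrite -hm; nra.
  have s1 : 0 < sin (- (h * l)) by apply: sin_gt0_pi; apply/andP; split; lra.
  have s2 : 0 < sin (al - h * l) by apply: sin_gt0_pi; apply/andP; split; lra.
  by move: s1; rewrite sinN => s1; have := mulr_gt0 s1 s2; lra.
Qed.

Lemma center_inj phi : injective (center phi).
Proof.
move=> j k jk; apply/eqP; apply: contraT => /(@dot_center_lt phi k j).
move=> /(_ (phi + 2 * pi / m%:R * k%:R)).
by rewrite subrr normr0 divr_gt0 ?pi_gt0// jk ltxx => /(_ isT).
Qed.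

(** The open Voronoi cell of a center, which makes cells disjoint and Borel
without any reference to angles, cut down to a small disk so that its points
are close to the center. *)
Definition cell phi (j : 'I_m) : set R[i] := [set z |
  (forall k, k != j -> dot z (center phi k) < dot z (center phi j)) /\
  normc (z - center phi j) ^+ 2 <= 2 * pi / m%:R].

Lemma cell_disjoint phi j k z : cell phi j z -> cell phi k z -> j = k.
Proof.
move=> [zj _] [zk _]; apply/eqP; apply: contraT => jk.
by have := lt_trans (zk j jk) (zj k _); rewrite eq_sym ltxx jk => /(_ isT).
Qed.

Lemma one_subr_cos_le theta : 0 <= theta -> 1 - cos theta <= theta.
Proof.
move=> t0; have [//|y _] := MVT_segment t0 (fun y _ => @is_derive_cos R y).
  by apply: continuous_subspaceT => y; exact: continuous_cos.
rewrite cos0 subr0 => e; have := sin_geN1 y; have := sin_le1 y.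
by nra.
Qed.

Lemma cell_expi phi (j : 'I_m) theta :
    `|theta - (phi + 2 * pi / m%:R * j%:R)| < pi / m%:R ->
  cell phi j (expi theta).
Proof.
move=> tj; split=> [k kj|]; first exact: dot_center_lt.
rewrite sqr_normc.
have -> : Re (expi theta - center phi j) ^+ 2 +
    Im (expi theta - center phi j) ^+ 2 =
    2 * (1 - dot (expi theta) (center phi j)).
  rewrite /dot /center /expi/=; set t := phi + _.
  by have := cos2Dsin2 theta; have := cos2Dsin2 t; lra.
rewrite dot_expi -cos_norm.
have := one_subr_cos_le (normr_ge0 (theta - (phi + 2 * pi / m%:R * j%:R))).
by move: tj; lra.
Qed.

Lemma cell_Re_ge phi j (c z : R[i]) (eps : R) :
    0 <= eps -> 2 * pi / m%:R <= eps ^+ 2 ->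
  cell phi j z -> Re (c * center phi j) - eps * normc c <= Re (c * z).
Proof.
move=> e0 me [_ /le_trans/(_ me)]; rewrite ler_sqr ?nnegrE ?normc_ge0// => ze.
have ReB (u v : R[i]) : Re u = Re v + Re (u - v).
  by case: u v => [? ?] [? ?] /=; ring.
rewrite (ReB (c * z) (c * center phi j)) -mulrBr.
rewrite lerD2l lerNl; apply: le_trans (ler_norm _) _; rewrite normrN.
apply: le_trans (normr_Re_le _) _; rewrite ComplexField.Normc.normcM mulrC.
by rewrite ler_wpM2r// normc_ge0.
Qed.

End arc_centers.
End roots_of_unity.

(** * From counting to probability *)

Section transfer.
Variable R : realType.
Local Open Scope complex_scope.
Local Notation normc := ComplexField.Normc.normc.
Local Notation Re := complex.Re.
Local Notation Im := complex.Im.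

Lemma borelC_preimage (f : R[i] -> R) (A : set R) :
    measurable_fun setT (fun p : R * R => f (p.1 +i* p.2)) -> measurable A ->
  borelC (f @^-1` A).
Proof. by move=> mf mA; rewrite /borelC -[X in measurable X]setTI; exact: mf. Qed.

Lemma measurable_Re_mul (c : R[i]) :
  measurable_fun setT (fun p : R * R => Re (c * (p.1 +i* p.2))).
Proof.
case: c => u v /=; apply: measurable_funB; apply: measurable_funM => //.
Qed.

Lemma measurable_dot (w : R[i]) :
  measurable_fun setT (fun p : R * R => dot (p.1 +i* p.2) w).
Proof. by rewrite /dot/=; apply: measurable_funD; apply: measurable_funM. Qed.

Lemma borelC_set1 (z : R[i]) : borelC [set z].
Proof.
rewrite /borelC; case: z => u v.
have -> : [set p : R * R | [set (u +i* v)] (p.1 +i* p.2)] = [set u] `*` [set v].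
  by apply/seteqP; split=> -[x y] /= => [[-> ->]|[-> ->]].
by apply: measurableX; exact: measurable_set1.
Qed.

Lemma borelC_cell m phi (j : 'I_m) : borelC (cell phi j : set R[i]).
Proof.
rewrite /borelC.
have -> : [set p : R * R | (cell phi j : set R[i]) (p.1 +i* p.2)] =
   (\bigcap_(k in [set k | k != j])
      [set p : R * R | dot (p.1 +i* p.2) (center phi k) <
                       dot (p.1 +i* p.2) (center phi j)]) `&`
   [set p : R * R | normc (p.1 +i* p.2 - center phi j) ^+ 2 <= 2 * pi / m%:R].
  by apply/seteqP; split=> p [] /= h1 h2.
apply: measurableI.
  apply: fin_bigcap_measurable; first exact: finite_finset.
  move=> k _; rewrite -[X in measurable X]setTI.
  by apply: (measurable_fun_ltr (measurable_dot _) (measurable_dot _)).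
rewrite -[X in measurable X]setTI.
have mq : measurable_fun setT
    (fun p : R * R => normc (p.1 +i* p.2 - center phi j) ^+ 2).
  rewrite (_ : (fun p : R * R => _) = (fun p : R * R =>
     (p.1 - Re (center phi j)) ^+ 2 + (p.2 - Im (center phi j)) ^+ 2)); last first.
    by apply/funext => p; rewrite sqr_normc.
  by apply: measurable_funD; apply: measurable_funX; apply: measurable_funB.
by apply: (measurable_fun_ler mq (measurable_cst _)).
Qed.

Lemma measurable_expi_preimage (B : set R[i]) :
  borelC B -> measurable (@expi R @^-1` B).
Proof.
move=> mB; rewrite -[X in measurable X]setTI.
have mf : measurable_fun setT (fun t : R => (cos t, sin t)).
  by apply: measurable_fun_pair; apply: continuous_measurable_fun;
    [exact: continuous_cos|exact: continuous_sin].
exact: mf mB.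
Qed.

Section probability.
Context (d : measure_display) (T : measurableType d) (P : probability T R).

Lemma uniform_circle_cell m (m3 : (3 <= m)%N) (X : T -> R[i]) (j : 'I_m) :
  uniform_on_Omega P None X ->
  ((m%:R^-1)%:E <= P (X @^-1` cell (pi / m%:R) j))%E.
Proof.
move=> /(_ _ (borelC_cell (pi / m%:R) j)) ->.
have m0 : 0 < m%:R :> R by rewrite ltr0n; case: m m3 j.
set h : R := 2 * pi / m%:R.
have h0 : 0 < h by rewrite divr_gt0 ?mulr_gt0 ?pi_gt0.
have hm : m%:R * h = 2 * pi by rewrite /h mulrC divfK ?gt_eqF.
have ph : pi / m%:R = h / 2 by rewrite /h; field; rewrite gt_eqF.
have sub : `]h * j%:R, h * j%:R + h[ `<=`
    `[0%R, (2 * pi)%R] `&` @expi R @^-1` cell (pi / m%:R) j.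
  move=> t /=; rewrite in_itv/= => /andP[t1 t2].
  have jm : j%:R + 1 <= m%:R :> R by rewrite natr1 ler_nat.
  have j0 : 0 <= j%:R :> R by [].
  split; first by rewrite in_itv/= -hm; apply/andP; split; nra.
  apply: cell_expi => //; rewrite -/h ph ltr_norml; apply/andP; split; lra.
have mcell := measurable_expi_preimage (borelC_cell (pi / m%:R) j).
have mu_sub : (lebesgue_measure `](h * j%:R)%R, (h * j%:R + h)%R[ <=
    lebesgue_measure (`[0%R, (2 * pi)%R] `&` @expi R @^-1` cell (pi / m%:R) j))%E.
  by apply: le_measure => //; rewrite inE//; exact: measurableI.
have pi20 : 0 < 2 * pi :> R by rewrite mulr_gt0// pi_gt0.
apply: (@le_trans _ _ ((2 * pi)^-1%:E * h%:E)%E).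
  by rewrite -EFinM lee_fin /h mulrA mulVf ?mul1r// gt_eqF.
rewrite lee_pmul2l//; last by rewrite lte_fin invr_gt0.
apply: le_trans mu_sub; rewrite lebesgue_measure_itv/= lte_fin ltrDl h0.
by rewrite -EFinB lee_fin; lra.
Qed.

(** For each [f] counted in [G], the event that every [X i] falls into the set
indexed by [f i] has probability at least [m ^- n] by independence, and these
events are disjoint. *)
Lemma freq_le_probability n m (X : 'I_n -> T -> R[i]) (B : 'I_m -> set R[i])
    (G : pred {ffun 'I_n -> 'I_m}) (E : set T) :
    (forall i, complex_rv (X i)) -> mutually_independent P X ->
    (forall j, borelC (B j)) ->
    (forall j k z, B j z -> B k z -> j = k) ->
    (forall i j, (m%:R^-1)%:E <= P (X i @^-1` B j))%E ->
    measurable E ->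
    (forall f t, G f -> (forall i, B (f i) (X i t)) -> E t) ->
  ((freq R G)%:E <= P E)%E.
Proof.
move=> mX indep mB dB PB mE GE.
pose F (f : {ffun 'I_n -> 'I_m}) :=
  \bigcap_(i in [set` [set: 'I_n]%SET]) (X i @^-1` B (f i)).
have mF f : measurable (F f).
  by apply: fin_bigcap_measurable => [|i _]; [exact: finite_finset|exact: mX].
have PF f : (((m%:R^-1) ^+ n)%:E <= P (F f))%E.
  rewrite /F indep => [|i]; last exact: mB.
  have pE i : P (X i @^-1` B (f i)) = (fine (P (X i @^-1` B (f i))))%:E.
    by rewrite fineK// fin_num_measure//; exact: mX.
  under eq_bigr do rewrite pE.
  rewrite prodEFin lee_fin.
  rewrite [leRHS](eq_bigl xpredT) => [|i]; last by rewrite inE.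
  rewrite -[X in _ ^+ X]card_ord -prodr_const; apply: ler_prod => i _.
  by rewrite invr_ge0 ler0n/= -lee_fin -pE.
have -> : (freq R G)%:E = (\sum_(f | G f) ((m%:R^-1) ^+ n)%:E)%E.
  rewrite sumEFin /freq /mean card_ffun !card_ord natrX -exprVn mulr_suml.
  rewrite [in RHS]big_mkcond/=.
  by congr EFin; apply: eq_bigr => f _; case: (G f); rewrite ?mul1r ?mul0r.
apply: (@le_trans _ _ (P (\bigcup_(f in [set` G]) F f))).
  rewrite measure_fin_bigcup//; last first.
    move=> f g _ _ [t [/= Ff Fg]]; apply/ffunP => i.
    by apply: (dB _ _ (X i t)); [apply: Ff|apply: Fg]; rewrite /= inE.
  rewrite -(@bigfs _ _ _ _ (index_enum _))//; last first.
  - by move=> f _; rewrite mem_index_enum.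
  - exact: index_enum_uniq.
  by apply: lee_sum => f _; exact: PF.
apply: le_measure; rewrite ?inE//.
  by apply: fin_bigcup_measurable => [|f _]; [exact: finite_finset|].
move=> t [f /= Gf Ff]; apply: (GE f) => // i; apply: Ff; by rewrite /= inE.
Qed.

End probability.
End transfer.

Theorem theorem4p4 (R : realType) (delta : R) (hdelta : 0 < delta < 16^-1) :
  exists c1 : R, 0 < c1 /\
    forall (m : option nat) (hm : admissible m) (n : nat) (hn : (0 < n)%N)
      (d : measure_display) (T : measurableType d) (P : probability T R)
      (xi : T -> 'cV[R[i]%C]_n) (hxi : iid_uniform P m xi)
      (a : 'cV[R[i]%C]_n),
      ((c1 / ((c2 m)%:R * n%:R `^ (5 * delta)))%:E <=
       P [set t | (Num.sqrt (delta * ln n%:R / n%:R) * norm1 a <=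
                   complex.Re ((a^T *m xi t) 0 0))%R])%E.
Proof.
have [C C0 finite_bound] := freq_sum_ge_pow_card hdelta.
exists C; split=> // m hm n hn d T P xi [mxi uxi ixi] a.
have [tau tau_gt count] := finite_bound n hn.
set s := Num.sqrt _ in tau_gt *.
have c2_ge1 : 1 <= (c2 m)%:R :> R.
  rewrite ler1n; case: m hm {uxi} => [k k3|//].
  by have [c2k _ _ _] := c2_min (ltnW k3); exact: ltnW.
apply: (@le_trans _ _ (C / n%:R `^ (5 * delta))%:E).
  have p0 : 0 < n%:R `^ (5 * delta) by rewrite powR_gt0// ltr0n.
  rewrite lee_fin invfM mulrA ler_pM2r ?invr_gt0//.
  by rewrite ler_pdivrMr ?ler_peMr ?(ltW C0)// (lt_le_trans _ c2_ge1).
have ReE t : complex.Re ((a^T *m xi t) 0 0) = \sum_i complex.Re (a i 0 * xi t i 0).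
  by rewrite mxE Re_sum; apply: eq_bigr => i _; rewrite mxE.
have mE : measurable [set t | s * norm1 a <= complex.Re ((a^T *m xi t) 0 0)].
  have mRe : measurable_fun setT (fun t => complex.Re ((a^T *m xi t) 0 0)).
    under eq_fun do rewrite ReE.
    apply: measurable_sum => i _ A mA; rewrite setTI.
    exact: (mxi i _ (borelC_preimage (f := fun z => complex.Re (a i 0 * z))
      (measurable_Re_mul (a i 0)) mA)).
  rewrite -[X in measurable X]setTI.
  by apply: (measurable_fun_ler (measurable_cst _) mRe).
(* Both cases of the theorem are instances of the following discretization,
   with error [eps = 0] for integer [m]. *)
have approx m' phi (B : 'I_m' -> set R[i]%C) (eps : R) : (3 <= m')%N ->
    s + eps <= tau ->
    (forall j, borelC (B j)) ->
    (forall j k z, B j z -> B k z -> j = k) ->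
    (forall i j, ((m'%:R^-1)%:E <= P ((fun t => xi t i 0%R) @^-1` B j))%E) ->
    (forall j c z, B j z ->
      complex.Re (c * center phi j) - eps * ComplexField.Normc.normc c <=
        complex.Re (c * z)) ->
  ((C / n%:R `^ (5 * delta))%:E <=
     P [set t | (s * norm1 a <= complex.Re ((a^T *m xi t) 0 0))%R])%E.
  move=> m3 stau mB dB PB ReB.
  have := count 'I_n 'I_m' _ _ (card_ord n) _ (fun i => spread_center m3 phi (a i 0)).
  rewrite card_ord (leq_trans _ m3)// => /(_ isT) h.
  apply: le_trans (_ : (_%:E <= _)%E) (freq_le_probability mxi ixi mB dB PB mE _).
    by rewrite lee_fin; exact: h.
  move=> f t /= Gf Bf; rewrite ReE.
  have : \sum_i (complex.Re (a i 0 * center phi (f i)) -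
                 eps * ComplexField.Normc.normc (a i 0)) <=
      \sum_i complex.Re (a i 0 * xi t i 0) by apply: ler_sum => i _; exact: ReB.
  apply: le_trans; rewrite sumrB -mulr_sumr -/(norm1 a).
  have na0 : 0 <= norm1 a by apply: sumr_ge0 => i _; exact: normc_ge0.
  by have := ler_wpM2r na0 stau; rewrite -/(norm1 a) in Gf; lra.
case: m hm uxi {c2_ge1} => [k k3|_] uxi.
  apply: (approx k 0 (fun j => [set center 0 j]) 0) => //.
  - by rewrite addr0 ltW.
  - by move=> j; exact: borelC_set1.
  - by move=> j i z -> /(center_inj k3).
  - move=> i j; rewrite uxi//; exists j; first exact: ltn_ord.
    by rewrite centerE expi0 mul1r.
  - by move=> j c z ->; rewrite mul0r subr0.
have eps0 : 0 < tau - s by rewrite subr_gt0.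
pose m' := maxn 3 (Num.bound (2 * pi / (tau - s) ^+ 2)).
have m3 : (3 <= m')%N by rewrite leq_maxl.
have m'0 : 0 < m'%:R :> R by rewrite ltr0n (leq_trans _ m3).
have m'eps : 2 * pi / m'%:R <= (tau - s) ^+ 2.
  rewrite ler_pdivrMr// [leRHS]mulrC -ler_pdivrMr ?exprn_gt0//.
  apply: (@le_trans _ _ (Num.bound (2 * pi / (tau - s) ^+ 2))%:R).
    by rewrite ltW// archi_boundP// divr_ge0 ?sqr_ge0// mulr_ge0// pi_ge0.
  by rewrite ler_nat leq_maxr.
apply: (approx m' (pi / m'%:R) (cell (pi / m'%:R)) (tau - s)) => //.
- by rewrite addrC subrK.
- by move=> j; exact: borelC_cell.
- by move=> j k z; exact: cell_disjoint.
- by move=> i j; exact: uniform_circle_cell.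
- by move=> j c z; apply: cell_Re_ge => //; exact: ltW.
Qed.
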